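(* Let $E$ be a group, let $N$ be a central subgroup of $E$, and put $G=E/N$. Let $\mathcal K(E)$ denote the set of commutators in $E$. Let $\eta_*:B_0(E)\to B_0(G)$ be the homomorphism induced by $\widetilde x\wedge\widetilde y\mapsto \widetilde xN\wedge\widetilde yN$, and let $\xi_*:B_0(G)\to \frac{N\cap[E,E]}{\langle\mathcal K(E)\cap N\rangle}$ be the homomorphism induced by $\widetilde xN\wedge\widetilde yN\mapsto[\widetilde x,\widetilde y]$ (for $\widetilde x,\widetilde y\in E$). Then the sequence $$B_0(E)\overset{\eta_*}{\longrightarrow} B_0(E/N)\overset{\xi_*}{\longrightarrow}\frac{N\cap [E,E]}{\langle \mathcal K(E)\cap N\rangle}$$ is exact, and in particular there is an isomorphism $$B_0(E/N)/\eta_*(B_0(E))\simeq \frac{N\cap [E,E]}{\langle \mathcal K(E)\cap N\rangle}.$$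
   Context: Write $x^y=y^{-1}xy$ and $[x,y]=x^{-1}y^{-1}xy$. For a group $H$, the nonabelian exterior square $H\wedge H$ is the group generated by symbols $x\wedge y$ ($x,y\in H$) subject to the relations $xy\wedge z=(x^y\wedge z^y)(y\wedge z)$, $x\wedge yz=(x\wedge z)(x^z\wedge y^z)$, $x\wedge x=1$ for all $x,y,z\in H$. The commutator map $\kappa:H\wedge H\to[H,H]$, $x\wedge y\mapsto[x,y]$, is a well-defined homomorphism. Put $M(H)=\ker\kappa$, let $M_0(H)$ be the subgroup of $M(H)$ generated by all $x\wedge y$ with $x,y\in H$ commuting, and let $B_0(H)=M(H)/M_0(H)$ (for finite $H$ this is isomorphic to the Bogomolov multiplier of $H$). For $G=E/N$ with $N$ central in $E$, the element $[\widetilde x,\widetilde y]$ depends only on the cosets $\widetilde xN$ and $\widetilde yN$, and $\widetilde xN\wedge\widetilde yN\mapsto[\widetilde x,\widetilde y]$ defines a homomorphism $G\wedge G\to[E,E]$; its restriction to $M(G)$ has image $N\cap[E,E]$ and it maps $M_0(G)$ onto $\langle\mathcal K(E)\cap N\rangle$, the subgroup generated by all commutators of $E$ that lie in $N$. *)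

(* Defs.v *)
(* Groups are arbitrary, possibly infinite, groupType's. A subgroup of G is a *)
(* predicate S : groupClosed G; classically every subgroup is of this form,   *)
(* membership being made boolean by asbool. Conventions of monoid.v:          *)
(*   x ^ y = y^-1 * (x * y)   and   [~ x, y] = x^-1 * (y^-1 * (x * y)).       *)
From HB Require Import structures.
From mathcomp Require Import all_boot.
From mathcomp Require Import boolp.

Set Implicit Arguments.
Unset Strict Implicit.
Unset Printing Implicit Defensive.

Local Open Scope group_scope.
Local Open Scope quotient_scope.

HB.mixin Record isConjClosed (G : groupType) (S : {pred G}) := {
  gpredJr : {in S, forall x y, x ^ y \in S}
}.

#[short(type="normalClosed")]
HB.structure Definition NormalClosed G :=
  {S of isConjClosed G S & GroupClosed G S}.

HB.mixin Record isCentral (G : groupType) (S : {pred G}) := {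
  gpred_central : {in S, forall x y, commute x y}
}.

(* Closure under conjugation is redundant here; it is inherited so that a     *)
(* central subgroup is canonically a normal one. The factory below only asks  *)
(* for centrality.                                                            *)
#[short(type="centralClosed")]
HB.structure Definition CentralClosed G :=
  {S of isCentral G S & NormalClosed G S}.

HB.factory Record GroupClosed_isCentral (G : groupType) (S : {pred G})
    of GroupClosed G S := {
  gpred_central : {in S, forall x y, commute x y}
}.
HB.builders Context G S of GroupClosed_isCentral G S.
Lemma central_conj : {in S, forall x y, x ^ y \in S}.
Proof.
by move=> x Sx y; rewrite conjgE (gpred_central Sx) mulgA mulVg mul1g.
Qed.
HB.instance Definition _ := isConjClosed.Build G S central_conj.
HB.instance Definition _ := isCentral.Build G S gpred_central.
HB.end.

Section Subgroups.
Variable G : groupType.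
Implicit Type A B : {pred G}.

(* The subgroup generated by A.                                               *)
Definition geng A : {pred G} :=
  fun x => `[< forall H : groupClosed G, {subset A <= H} -> x \in H >].

Lemma gengP A x :
  reflect (forall H : groupClosed G, {subset A <= H} -> x \in H) (x \in geng A).
Proof. exact: asboolP. Qed.

Lemma mem_geng A : {subset A <= geng A}.
Proof. by move=> x Ax; apply/gengP => H; apply. Qed.

Lemma geng_sub A (H : groupClosed G) : {subset A <= H} -> {subset geng A <= H}.
Proof. by move=> sAH x /gengP; apply. Qed.

Section Geng.
Variable A : {pred G}.
Lemma geng1 : 1 \in geng A.
Proof. by apply/gengP => H _; apply: gpred1. Qed.
Lemma gengM : mulg_closed (geng A).
Proof.
by move=> x y /gengP Ax /gengP Ay; apply/gengP => H sAH; rewrite gpredM ?Ax ?Ay.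
Qed.
Lemma gengV : invg_closed (geng A).
Proof. by move=> x /gengP Ax; apply/gengP => H sAH; rewrite gpredV Ax. Qed.
HB.instance Definition _ := isMulClosed.Build G (geng A) gengM.
HB.instance Definition _ := isMul1Closed.Build G (geng A) geng1.
HB.instance Definition _ := isInvClosed.Build G (geng A) gengV.
End Geng.

Definition capg A B : {pred G} := [predI A & B].

Lemma capgP A B x : reflect (x \in A /\ x \in B) (x \in capg A B).
Proof. exact: andP. Qed.

Section Capg.
Variables A B : groupClosed G.
Lemma capg1 : 1 \in capg A B.
Proof. by apply/capgP; rewrite !gpred1. Qed.
Lemma capgM : mulg_closed (capg A B).
Proof.
by move=> x y /capgP[? ?] /capgP[? ?]; apply/capgP; rewrite !gpredM.
Qed.
Lemma capgV : invg_closed (capg A B).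
Proof. by move=> x /capgP[? ?]; apply/capgP; rewrite !gpredV. Qed.
HB.instance Definition _ := isMulClosed.Build G (capg A B) capgM.
HB.instance Definition _ := isMul1Closed.Build G (capg A B) capg1.
HB.instance Definition _ := isInvClosed.Build G (capg A B) capgV.
End Capg.

Section CentralCapg.
Variables (A : centralClosed G) (B : groupClosed G).
Lemma capg_central : {in capg A B, forall x y, commute x y}.
Proof. by move=> x /capgP[Ax _] y; apply: gpred_central Ax _. Qed.
HB.instance Definition _ :=
  GroupClosed_isCentral.Build G (capg A B) capg_central.
End CentralCapg.

Definition comms : {pred G} := fun z => `[< exists x y : G, z = [~ x, y] >].

Definition derg : {pred G} := geng comms.
HB.instance Definition _ := GroupClosed.on derg.

Lemma mem_comms x y : [~ x, y] \in comms.
Proof. by apply/asboolP; exists x, y. Qed.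

Lemma mem_derg x y : [~ x, y] \in derg.
Proof. exact/mem_geng/mem_comms. Qed.

End Subgroups.

Arguments comms G : clear implicits.
Arguments derg G : clear implicits.

Section SubgroupType.
Variables (G : groupType) (A : groupClosed G).

Record subg := Subg { sgval : G; sgvalP : sgval \in A }.

HB.instance Definition _ := [isSub for sgval].
HB.instance Definition _ := [Choice of subg by <:].

Lemma subg_closed : group_closed A.
Proof. by split; [exact: gpred1 | move=> x y; exact: gpredF]. Qed.
HB.instance Definition _ :=
  SubChoice_isSubGroup.Build G (fun x => x \in A) subg subg_closed.

End SubgroupType.

Section Morphisms.
Variables (G K : groupType) (f : UMagmaMorphism.type G K).

Definition kerg : {pred G} := fun x => f x == 1.
Definition img : {pred K} := fun y => `[< exists x, f x = y >].

Lemma kergP x : reflect (f x = 1) (x \in kerg).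
Proof. exact: eqP. Qed.

Lemma imgP y : reflect (exists x, f x = y) (y \in img).
Proof. exact: asboolP. Qed.

Lemma kerg1 : 1 \in kerg.
Proof. by apply/kergP; rewrite gmulf1. Qed.
Lemma kergM : mulg_closed kerg.
Proof. by move=> x y /kergP fx /kergP fy; apply/kergP; rewrite gmulfM fx fy mulg1. Qed.
Lemma kergV : invg_closed kerg.
Proof. by move=> x /kergP fx; apply/kergP; rewrite gmulfV fx invg1. Qed.
HB.instance Definition _ := isMulClosed.Build G kerg kergM.
HB.instance Definition _ := isMul1Closed.Build G kerg kerg1.
HB.instance Definition _ := isInvClosed.Build G kerg kergV.

Lemma img1 : 1 \in img.
Proof. by apply/imgP; exists 1; rewrite gmulf1. Qed.
Lemma imgM : mulg_closed img.
Proof.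
by move=> _ _ /imgP[x <-] /imgP[y <-]; apply/imgP; exists (x * y); rewrite gmulfM.
Qed.
Lemma imgV : invg_closed img.
Proof. by move=> _ /imgP[x <-]; apply/imgP; exists x^-1; rewrite gmulfV. Qed.
HB.instance Definition _ := isMulClosed.Build K img imgM.
HB.instance Definition _ := isMul1Closed.Build K img img1.
HB.instance Definition _ := isInvClosed.Build K img imgV.

Section Preimage.
Variable S : groupClosed K.
Definition preimg : {pred G} := fun x => f x \in S.
Lemma preimgE x : (x \in preimg) = (f x \in S).
Proof. by []. Qed.
Lemma preimg1 : 1 \in preimg.
Proof. by rewrite preimgE gmulf1 gpred1. Qed.
Lemma preimgM : mulg_closed preimg.
Proof. by move=> x y; rewrite !preimgE gmulfM; apply: gpredM. Qed.
Lemma preimgV : invg_closed preimg.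
Proof. by move=> x; rewrite !preimgE gmulfV; apply: gpredVr. Qed.
HB.instance Definition _ := isMulClosed.Build G preimg preimgM.
HB.instance Definition _ := isMul1Closed.Build G preimg preimg1.
HB.instance Definition _ := isInvClosed.Build G preimg preimgV.

Lemma geng_map (A : {pred G}) :
  {in A, forall x, f x \in S} -> {in geng A, forall x, f x \in S}.
Proof. by move=> fA; apply: (@geng_sub _ A preimg). Qed.
End Preimage.

End Morphisms.

Definition isomorphic (G K : groupType) : Prop :=
  exists f : UMagmaMorphism.type G K, bijective f.

Section Quotient.
Variables (G : groupType) (N : normalClosed G).

(* xN = yN                                                                    *)
Definition coset_rel : rel G := fun x y => x^-1 * y \in N.

Lemma coset_rel_refl : reflexive coset_rel.
Proof. by move=> x; rewrite /coset_rel mulVg gpred1. Qed.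
Lemma coset_rel_sym : symmetric coset_rel.
Proof. by move=> x y; rewrite /coset_rel -gpredV invgM invgK. Qed.
Lemma coset_rel_trans : transitive coset_rel.
Proof.
move=> y x z; rewrite /coset_rel => Nxy Nyz.
by rewrite -[z](mulVKg y) mulgA gpredM.
Qed.

Canonical coset_equiv :=
  EquivRel coset_rel coset_rel_refl coset_rel_sym coset_rel_trans.

Definition quotg := {eq_quot coset_equiv}.
HB.instance Definition _ := Choice.on quotg.

Definition cosetg (x : G) : quotg := \pi_quotg x.

Lemma cosetgP x y : reflect (cosetg x = cosetg y) (x^-1 * y \in N).
Proof. exact: (iffP (eqmodP coset_equiv x y)). Qed.

Lemma cosetg_repr a : cosetg (repr a) = a.
Proof. exact: reprK. Qed.

Lemma repr_cosetg x : (repr (cosetg x))^-1 * x \in N.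
Proof. by apply/cosetgP; rewrite cosetg_repr. Qed.

Definition quotg1 : quotg := cosetg 1.
Definition quotgM (a b : quotg) : quotg := cosetg (repr a * repr b).
Definition quotgV (a : quotg) : quotg := cosetg (repr a)^-1.

Lemma cosetg_mul x y : cosetg (x * y) = quotgM (cosetg x) (cosetg y).
Proof.
apply/esym/cosetgP; have := repr_cosetg x; have := repr_cosetg y.
move: (repr (cosetg x)) (repr (cosetg y)) => a b Ny Nx.
have -> : (a * b)^-1 * (x * y) = (a^-1 * x) ^ b * (b^-1 * y).
  by rewrite conjgE invgM -!mulgA mulVKg.
by rewrite gpredM ?gpredJr.
Qed.

Lemma cosetg_inv x : cosetg x^-1 = quotgV (cosetg x).
Proof.
apply/esym/cosetgP; have := repr_cosetg x; move: (repr _) => a Nx.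
rewrite invgK; have -> : a * x^-1 = (x^-1 * a) ^ x^-1 by rewrite conjgE invgK mulgA mulVKg.
by rewrite gpredJr // -gpredV invgM invgK.
Qed.

Lemma quotg_ind (P : quotg -> Prop) : (forall x, P (cosetg x)) -> forall a, P a.
Proof. by move=> Px a; rewrite -[a]cosetg_repr. Qed.

Lemma quotgA : associative quotgM.
Proof.
elim/quotg_ind=> x; elim/quotg_ind=> y; elim/quotg_ind=> z.
by rewrite -!cosetg_mul mulgA.
Qed.
Lemma quotg1M : left_id quotg1 quotgM.
Proof. by elim/quotg_ind=> x; rewrite -cosetg_mul mul1g. Qed.
Lemma quotgM1 : right_id quotg1 quotgM.
Proof. by elim/quotg_ind=> x; rewrite -cosetg_mul mulg1. Qed.
Lemma quotgVM : left_inverse quotg1 quotgV quotgM.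
Proof. by elim/quotg_ind=> x; rewrite -cosetg_inv -cosetg_mul mulVg. Qed.
Lemma quotgMV : right_inverse quotg1 quotgV quotgM.
Proof. by elim/quotg_ind=> x; rewrite -cosetg_inv -cosetg_mul mulgV. Qed.

HB.instance Definition _ :=
  isGroup.Build quotg quotgA quotg1M quotgM1 quotgVM quotgMV.

HB.instance Definition _ :=
  isUMagmaMorphism.Build G quotg cosetg (erefl, cosetg_mul).

Lemma cosetg_eq1 x : (cosetg x = 1) <-> (x \in N).
Proof.
split=> [/esym/cosetgP|Nx]; first by rewrite invg1 mul1g.
by apply/esym/cosetgP; rewrite invg1 mul1g.
Qed.

End Quotient.

(* For B <= A, A central in G, the group A / B. In general it is A / (A n B). *)
Section SectionGroup.
Variables (G : groupType).

Definition restrg (A : groupClosed G) (B : {pred G}) : {pred subg A} :=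
  fun t => sgval t \in B.
Arguments restrg : clear implicits.

Section RestrClosed.
Variables (A : centralClosed G) (B : groupClosed G).
Lemma restrg1 : 1 \in restrg A B.
Proof. exact: gpred1. Qed.
Lemma restrgM : mulg_closed (restrg A B).
Proof. by move=> x y; apply: gpredM. Qed.
Lemma restrgV : invg_closed (restrg A B).
Proof. by move=> x; apply: gpredVr. Qed.
HB.instance Definition _ := isMulClosed.Build (subg A) (restrg A B) restrgM.
HB.instance Definition _ := isMul1Closed.Build (subg A) (restrg A B) restrg1.
HB.instance Definition _ := isInvClosed.Build (subg A) (restrg A B) restrgV.

Lemma subg_commute (x y : subg A) : commute x y.
Proof. by apply: val_inj; exact: (@gpred_central _ A _ (sgvalP x)). Qed.

HB.instance Definition _ := GroupClosed_isCentral.Build (subg A) (restrg A B)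
  (fun x _ y => subg_commute x y).

Definition secg := quotg (restrg A B).
HB.instance Definition _ := Group.on secg.

Lemma secg_commute (a b : secg) : commute a b.
Proof.
elim/quotg_ind: a => x; elim/quotg_ind: b => y.
by rewrite /commute -!gmulfM subg_commute.
Qed.

Definition to_secg (x : G) (Ax : x \in A) : secg :=
  cosetg (restrg A B) (Subg Ax).

Lemma to_secgP x y (Ax : x \in A) (Ay : y \in A) :
  to_secg Ax = to_secg Ay <-> x^-1 * y \in B.
Proof. by split=> [/cosetgP//|Bxy]; apply/cosetgP. Qed.

Lemma to_secg1 (A1 : 1 \in A) : to_secg A1 = 1.
Proof. by congr cosetg; apply: val_inj. Qed.

Lemma to_secgM x y (Ax : x \in A) (Ay : y \in A) (Axy : x * y \in A) :
  to_secg Axy = to_secg Ax * to_secg Ay.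
Proof.
apply: etrans (cosetg_mul _ _ _); congr cosetg; exact: val_inj.
Qed.

Lemma secg_ind (P : secg -> Prop) :
  (forall x (Ax : x \in A), P (to_secg Ax)) -> forall a, P a.
Proof. by move=> Px; elim/quotg_ind=> -[x Ax]; apply: Px. Qed.

Section CentralImage.
Variables (H : groupType) (f : UMagmaMorphism.type H secg).
HB.instance Definition _ := GroupClosed_isCentral.Build secg (img f)
  (fun x _ y => secg_commute x y).
End CentralImage.

End RestrClosed.
End SectionGroup.
Arguments restrg {G} A B.

Section SectionMap.
Variables (G K : groupType) (f : UMagmaMorphism.type G K).
Variables (A : centralClosed G) (B : groupClosed G).
Variables (A' : centralClosed K) (B' : groupClosed K).
Hypothesis (fA : {in A, forall x, f x \in A'}).
Hypothesis (fB : {in B, forall x, f x \in B'}).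

(* The map A / B -> A' / B' induced by f; it is independent of the choice of  *)
(* representatives when f B <= B', see secg_mapE.                             *)
Definition secg_map (a : secg A B) : secg A' B' :=
  to_secg B' (fA (sgvalP (repr a))).

Lemma secg_mapE x (Ax : x \in A) :
  secg_map (to_secg B Ax) = to_secg B' (fA Ax).
Proof.
apply/to_secgP; rewrite -gmulfV -gmulfM; apply: fB.
exact: (@repr_cosetg _ (restrg A B) (Subg Ax)).
Qed.

Lemma secg_mapM : monoid_morphism secg_map.
Proof.
have A1 := @gpred1 _ A; split.
  by rewrite -(to_secg1 B A1) secg_mapE -(to_secg1 B' (@gpred1 _ A'));
     apply/to_secgP; rewrite gmulf1 mulVg gpred1.
elim/secg_ind=> x Ax; elim/secg_ind=> y Ay.
have Axy : x * y \in A by apply: gpredM.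
have A'xy : f x * f y \in A' by rewrite -gmulfM fA.
rewrite -(to_secgM B Ax Ay Axy) !secg_mapE -(to_secgM _ _ _ A'xy).
by apply/to_secgP; rewrite gmulfM mulVg gpred1.
Qed.
End SectionMap.
Arguments secg_map {G K f A B A' B'} fA a.
Arguments secg_mapE {G K f A B A' B'} fA fB x Ax.
Arguments secg_mapM {G K f A B A' B'} fA fB.

(* The group < X | R > : words in the letters (x, false) = x and              *)
(* (x, true) = x^-1, modulo the congruence generated by free cancellation and *)
(* by the pairs in R.                                                         *)
Section Presentation.
Variable X : choiceType.

Definition word := seq (X * bool).

Implicit Types (u v w : word).

Section Eval.
Variables (K : groupType) (f : X -> K).

Definition letter_eval (l : X * bool) : K := if l.2 then (f l.1)^-1 else f l.1.
Definition word_eval w : K := \prod_(l <- w) letter_eval l.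

Lemma word_eval_cat u v : word_eval (u ++ v) = word_eval u * word_eval v.
Proof. exact: big_cat. Qed.
End Eval.

Variable R : word -> word -> Prop.

Inductive pres_eqv : word -> word -> Prop :=
| pres_refl u : pres_eqv u u
| pres_sym u v : pres_eqv u v -> pres_eqv v u
| pres_trans u v w : pres_eqv u v -> pres_eqv v w -> pres_eqv u w
| pres_cat u u' v v' :
    pres_eqv u u' -> pres_eqv v v' -> pres_eqv (u ++ v) (u' ++ v')
| pres_cancel x b : pres_eqv [:: (x, b); (x, ~~ b)] [::]
| pres_rel u v : R u v -> pres_eqv u v.

Definition pres_eqvb : rel word := fun u v => `[< pres_eqv u v >].

Lemma pres_eqvb_refl : reflexive pres_eqvb.
Proof. by move=> u; apply/asboolP/pres_refl. Qed.
Lemma pres_eqvb_sym : symmetric pres_eqvb.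
Proof. by move=> u v; apply/asboolP/asboolP => /pres_sym. Qed.
Lemma pres_eqvb_trans : transitive pres_eqvb.
Proof. by move=> v u w /asboolP uv /asboolP vw; apply/asboolP/(pres_trans uv). Qed.

Canonical pres_equiv :=
  EquivRel pres_eqvb pres_eqvb_refl pres_eqvb_sym pres_eqvb_trans.

Definition presg := {eq_quot pres_equiv}.
HB.instance Definition _ := Choice.on presg.

Definition presg_class u : presg := \pi_presg u.

Lemma presg_classP u v : presg_class u = presg_class v <-> pres_eqv u v.
Proof.
by split=> [/(eqmodP pres_equiv)/asboolP|uv]; [|apply/(eqmodP pres_equiv)/asboolP].
Qed.

Lemma presg_class_repr a : presg_class (repr a) = a.
Proof. exact: reprK. Qed.

Lemma repr_presg_class u : pres_eqv (repr (presg_class u)) u.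
Proof. by apply/presg_classP; rewrite presg_class_repr. Qed.

Definition word_inv u : word := rev [seq (l.1, ~~ l.2) | l <- u].

Lemma word_invV u : pres_eqv (word_inv u ++ u) [::].
Proof.
elim: u => [|[x b] u IHu]; first exact: pres_refl.
rewrite /word_inv /= rev_cons cat_rcons -cat1s -[(x, b) :: u]cat1s.
rewrite [X in word_inv u ++ X]catA; apply: pres_trans IHu.
apply: pres_cat; first exact: pres_refl.
rewrite -[X in pres_eqv _ X]cat0s; apply: pres_cat; last exact: pres_refl.
by have := pres_cancel x (~~ b); rewrite negbK.
Qed.

Lemma word_invK : involutive word_inv.
Proof.
move=> u; rewrite /word_inv map_rev revK -map_comp map_id_in // => -[x b] _ /=.
by rewrite negbK.
Qed.

Definition presg1 : presg := presg_class [::].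
Definition presgM (a b : presg) : presg := presg_class (repr a ++ repr b).
Definition presgV (a : presg) : presg := presg_class (word_inv (repr a)).

Lemma presg_class_cat u v :
  presg_class (u ++ v) = presgM (presg_class u) (presg_class v).
Proof.
by apply/presg_classP/pres_sym/pres_cat; apply: repr_presg_class.
Qed.

Lemma presg_word_ind (P : presg -> Prop) :
  (forall u, P (presg_class u)) -> forall a, P a.
Proof. by move=> Pu a; rewrite -[a]presg_class_repr. Qed.

Lemma presgA : associative presgM.
Proof.
elim/presg_word_ind=> u; elim/presg_word_ind=> v; elim/presg_word_ind=> w.
by rewrite -!presg_class_cat catA.
Qed.
Lemma presg1M : left_id presg1 presgM.
Proof. by elim/presg_word_ind=> u; rewrite -presg_class_cat. Qed.
Lemma presgM1 : right_id presg1 presgM.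
Proof. by elim/presg_word_ind=> u; rewrite -presg_class_cat cats0. Qed.
Lemma presgVM : left_inverse presg1 presgV presgM.
Proof.
move=> a; rewrite /presgV -[X in presgM _ X]presg_class_repr.
by rewrite -presg_class_cat; apply/presg_classP/word_invV.
Qed.
Lemma presgMV : right_inverse presg1 presgV presgM.
Proof.
move=> a; rewrite /presgV -[X in presgM X]presg_class_repr.
rewrite -presg_class_cat -[X in X ++ _]word_invK.
exact/presg_classP/word_invV.
Qed.

HB.instance Definition _ :=
  isGroup.Build presg presgA presg1M presgM1 presgVM presgMV.

Definition presg_gen (x : X) : presg := presg_class [:: (x, false)].

Lemma presg_ind (P : presg -> Prop) :
    P 1 -> (forall a b, P a -> P b -> P (a * b)) ->
    (forall a, P a -> P a^-1) -> (forall x, P (presg_gen x)) ->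
  forall a, P a.
Proof.
move=> P1 PM PV Px; elim/presg_word_ind; elim=> [|[x b] u IHu] //.
rewrite -cat1s presg_class_cat; apply: PM IHu.
case: b; last exact: Px.
have -> : presg_class [:: (x, true)] = (presg_gen x)^-1; last exact: PV.
apply/esym/mulg1_eq; rewrite -[LHS]presg_class_cat.
exact/presg_classP/pres_cancel.
Qed.

Section Lift.
Variables (K : groupType) (f : X -> K).
Hypothesis fR : forall u v, R u v -> word_eval f u = word_eval f v.

Definition presg_lift (a : presg) : K := word_eval f (repr a).

Lemma presg_lift_class u : presg_lift (presg_class u) = word_eval f u.
Proof.
have := repr_presg_class u; rewrite /presg_lift; move: (repr _) => v.
elim=> //= {u v}.
- by move=> u v w _ -> _ ->.
- by move=> u u' v v' _ uu' _ vv'; rewrite !word_eval_cat uu' vv'.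
- move=> x b; rewrite /word_eval !big_cons !big_nil mulg1 /letter_eval /=.
  by case: b; rewrite ?mulVg ?mulgV.
Qed.

Lemma presg_liftM : monoid_morphism presg_lift.
Proof.
split; first by rewrite [LHS]presg_lift_class /word_eval big_nil.
elim/presg_word_ind=> u; elim/presg_word_ind=> v.
by rewrite -[_ * _]presg_class_cat !presg_lift_class word_eval_cat.
Qed.
HB.instance Definition _ :=
  isUMagmaMorphism.Build presg K presg_lift presg_liftM.

End Lift.
End Presentation.

Section ExteriorSquare.
Variable H : groupType.

Definition wedge_word (x y : H) : word (H * H)%type := [:: ((x, y), false)].

Inductive extsq_rel : word (H * H)%type -> word (H * H)%type -> Prop :=
| extsq_mull x y z :
    extsq_rel (wedge_word (x * y) z)
              (wedge_word (x ^ y) (z ^ y) ++ wedge_word y z)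
| extsq_mulr x y z :
    extsq_rel (wedge_word x (y * z))
              (wedge_word x z ++ wedge_word (x ^ z) (y ^ z))
| extsq_diag x : extsq_rel (wedge_word x x) [::].

Definition extsq := presg extsq_rel.
HB.instance Definition _ := Group.on extsq.

Definition wedge (x y : H) : extsq := presg_gen extsq_rel (x, y).

Lemma wedgeMl x y z : wedge (x * y) z = wedge (x ^ y) (z ^ y) * wedge y z.
Proof.
rewrite -[RHS](@presg_class_cat _ extsq_rel).
exact/presg_classP/pres_rel/extsq_mull.
Qed.
Lemma wedgeMr x y z : wedge x (y * z) = wedge x z * wedge (x ^ z) (y ^ z).
Proof.
rewrite -[RHS](@presg_class_cat _ extsq_rel).
exact/presg_classP/pres_rel/extsq_mulr.
Qed.
Lemma wedgexx x : wedge x x = 1.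
Proof. exact/presg_classP/pres_rel/extsq_diag. Qed.

Lemma extsq_ind (P : extsq -> Prop) :
    P 1 -> (forall s t, P s -> P t -> P (s * t)) ->
    (forall t, P t -> P t^-1) -> (forall x y, P (wedge x y)) ->
  forall t, P t.
Proof. by move=> P1 PM PV Pw; apply: presg_ind => //; case=> x y; apply: Pw. Qed.

Section Lift.
Variables (K : groupType) (phi : H -> H -> K).

Definition ext_pairing : Prop :=
  [/\ forall x y z, phi (x * y) z = phi (x ^ y) (z ^ y) * phi y z,
      forall x y z, phi x (y * z) = phi x z * phi (x ^ z) (y ^ z)
    & forall x, phi x x = 1].

Hypothesis phiP : ext_pairing.

Lemma extsq_lift_subproof u v : extsq_rel u v ->
  word_eval (fun p => phi p.1 p.2) u = word_eval (fun p => phi p.1 p.2) v.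
Proof.
case: phiP => phiMl phiMr phixx.
by case=> *; rewrite /word_eval !big_cons ?big_nil /letter_eval /= !mulg1.
Qed.

Definition extsq_lift : extsq -> K :=
  @presg_lift _ extsq_rel K (fun p => phi p.1 p.2).

Lemma extsq_liftM : monoid_morphism extsq_lift.
Proof. exact/presg_liftM/extsq_lift_subproof. Qed.

Lemma extsq_liftE x y : extsq_lift (wedge x y) = phi x y.
Proof.
rewrite [LHS]presg_lift_class; last exact: extsq_lift_subproof.
by rewrite /word_eval big_cons big_nil /letter_eval mulg1.
Qed.
End Lift.

Lemma commg_pairing : ext_pairing (@commg H).
Proof.
split=> [x y z|x y z|x]; last exact: commgg.
- by rewrite -conjRg !commgEl !conjgE ?invgM ?invgK ?mulgA ?mulgK ?mulgVK.
- by rewrite -conjRg !commgEl !conjgE ?invgM ?invgK ?mulgA ?mulgK ?mulgVK.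
Qed.

(* kappa takes its values in [H, H], see kappa_derg.                          *)
Definition kappa : extsq -> H := extsq_lift (@commg H).
HB.instance Definition _ :=
  isUMagmaMorphism.Build extsq H kappa (extsq_liftM commg_pairing).

Lemma kappaE x y : kappa (wedge x y) = [~ x, y].
Proof. exact/extsq_liftE/commg_pairing. Qed.

Lemma kappa_derg t : kappa t \in derg H.
Proof.
elim/extsq_ind: t => [|s t ? ?|t ?|x y].
- by rewrite gmulf1 gpred1.
- by rewrite gmulfM gpredM.
- by rewrite gmulfV gpredV.
- by rewrite kappaE mem_derg.
Qed.

Lemma wedge_comm x y a b :
  wedge x y * wedge a b = wedge a b * wedge (x ^ [~ a, b]) (y ^ [~ a, b]).
Proof.
have key u v : wedge (u ^ (b * a)) (v ^ (b * a)) * wedge a b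
             = wedge a b * wedge (u ^ (a * b)) (v ^ (a * b)).
  have E1 : wedge (u * a) (v * b) = wedge (u ^ a) (b ^ a) *
      (wedge (u ^ (b * a)) (v ^ (b * a)) * wedge a b) * wedge (a ^ b) (v ^ b).
    rewrite wedgeMl conjMg (wedgeMr (u ^ a) (v ^ a) (b ^ a)) (wedgeMr a v b).
    by rewrite -2!conjgM -(conjgC b a) !mulgA.
  have E2 : wedge (u * a) (v * b) = wedge (u ^ a) (b ^ a) *
      (wedge a b * wedge (u ^ (a * b)) (v ^ (a * b))) * wedge (a ^ b) (v ^ b).
    rewrite wedgeMr conjMg (wedgeMl (u ^ b) (a ^ b) (v ^ b)) (wedgeMl u a b).
    by rewrite -2!conjgM -(conjgC a b) !mulgA.
  by move: E1; rewrite E2 => /mulIg/mulgI.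
have := key (x ^ (b * a)^-1) (y ^ (b * a)^-1); rewrite !conjgKV -!conjgM => ->.
by rewrite commgEl conjgE invgM !mulgA.
Qed.

Lemma wedgeJ x y (t : extsq) :
  wedge x y * t = t * wedge (x ^ kappa t) (y ^ kappa t).
Proof.
elim/extsq_ind: t x y => [|s t IHs IHt|t IHt|a b] x y.
- by rewrite gmulf1 !conjg1 mul1g mulg1.
- by rewrite gmulfM !conjgM mulgA IHs -!mulgA IHt.
- rewrite gmulfV; apply: (mulgI t); rewrite mulVKg mulgA.
  apply: (mulIg t); rewrite mulgVK IHt.
  by rewrite -!conjgM mulVg !conjg1.
- by rewrite kappaE wedge_comm.
Qed.

(* M(H), M_0(H) and B_0(H).                                                   *)
Definition Mext : {pred extsq} := kerg kappa.
HB.instance Definition _ := GroupClosed.on Mext.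

Lemma MextP t : reflect (kappa t = 1) (t \in Mext).
Proof. exact: kergP. Qed.

Lemma Mext_central : {in Mext, forall s t, commute s t}.
Proof.
move=> s /MextP ks; elim/extsq_ind=> [|t u|t|x y].
- exact: commute1.
- exact: commuteM.
- exact: commuteV.
- by rewrite /commute wedgeJ ks !conjg1.
Qed.
HB.instance Definition _ := GroupClosed_isCentral.Build extsq Mext Mext_central.

Definition M0ext : {pred extsq} :=
  geng (fun t => `[< exists x y : H, commute x y /\ t = wedge x y >]).
HB.instance Definition _ := GroupClosed.on M0ext.

Lemma M0ext_sub : {subset M0ext <= Mext}.
Proof.
apply: geng_sub => t /asboolP[x [y [/commgP cxy ->]]].
by apply/MextP; rewrite kappaE (eqP cxy).
Qed.

Definition B0 := secg Mext M0ext.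
HB.instance Definition _ := Group.on B0.

End ExteriorSquare.

Arguments wedge {H} x y.
Arguments kappa {H} t.
Arguments Mext H : clear implicits.
Arguments M0ext H : clear implicits.

Section Functoriality.
Variables (G K : groupType) (f : UMagmaMorphism.type G K).

Lemma extsq_map_pairing : ext_pairing (fun x y => wedge (f x) (f y)).
Proof.
split=> [x y z|x y z|x]; last exact: wedgexx.
- by rewrite !gmulfJ gmulfM wedgeMl.
- by rewrite !gmulfJ gmulfM wedgeMr.
Qed.

Definition extsq_map : extsq G -> extsq K :=
  extsq_lift (fun x y => wedge (f x) (f y)).
HB.instance Definition _ := isUMagmaMorphism.Build (extsq G) (extsq K)
  extsq_map (extsq_liftM extsq_map_pairing).

Lemma extsq_mapE x y : extsq_map (wedge x y) = wedge (f x) (f y).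
Proof. exact: (extsq_liftE extsq_map_pairing). Qed.

Lemma kappa_extsq_map t : kappa (extsq_map t) = f (kappa t).
Proof.
elim/extsq_ind: t => [|s t IHs IHt|t IHt|x y].
- by rewrite !gmulf1.
- by rewrite !gmulfM /= IHs IHt.
- by rewrite !gmulfV /= IHt.
- by rewrite extsq_mapE !kappaE gmulfR.
Qed.

Lemma extsq_map_Mext : {in Mext G, forall t, extsq_map t \in Mext K}.
Proof. by move=> t /MextP kt; apply/MextP; rewrite kappa_extsq_map kt gmulf1. Qed.

Lemma extsq_map_M0ext : {in M0ext G, forall t, extsq_map t \in M0ext K}.
Proof.
apply: geng_map => t /asboolP[x [y [cxy ->]]]; rewrite /= extsq_mapE.
apply/mem_geng/asboolP; exists (f x), (f y); split=> //.
exact: gmulf_commute.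
Qed.

Definition B0_map : B0 G -> B0 K := secg_map extsq_map_Mext.
HB.instance Definition _ := isUMagmaMorphism.Build (B0 G) (B0 K) B0_map
  (secg_mapM extsq_map_Mext extsq_map_M0ext).

Lemma B0_mapE t (Mt : t \in Mext G) (Mft : extsq_map t \in Mext K) :
  B0_map (to_secg (M0ext G) Mt) = to_secg (M0ext K) Mft.
Proof.
rewrite [LHS](secg_mapE extsq_map_Mext extsq_map_M0ext).
by apply/to_secgP; rewrite mulVg gpred1.
Qed.

End Functoriality.

Section CentralQuotient.
Variables (E : groupType) (N : centralClosed E).

Definition eta_star : B0 E -> B0 (quotg N) := B0_map (cosetg N).
HB.instance Definition _ := UMagmaMorphism.on eta_star.

(* [x, y] as a function of the cosets xN and yN; see comm_liftE.              *)
Definition comm_lift (a b : quotg N) : E := [~ repr a, repr b].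

Lemma comm_liftE x y : comm_lift (cosetg N x) (cosetg N y) = [~ x, y].
Proof.
rewrite /comm_lift; have := repr_cosetg N x; have := repr_cosetg N y.
move: (repr (cosetg N x)) (repr (cosetg N y)) => a b Ny Nx.
rewrite -[x](mulVKg a) -[y](mulVKg b).
move: (a^-1 * x) (b^-1 * y) Nx Ny => n m /gpred_central Cn /gpred_central Cm.
have CJ (g z : E) : (forall w, commute g w) -> z ^ g = z.
  by move=> Cg; rewrite conjgE -Cg mulKg.
rewrite !commgEl !conjgM (CJ m) // conjMg invgM.
by rewrite [n ^ _]conjgE Cn mulKg -(Cn (a ^ b)) -mulgA [a^-1 * (n * _)]mulgA -(Cn a^-1) -mulgA mulKg.
Qed.

Lemma comm_lift_pairing : ext_pairing comm_lift.
Proof.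
case: (commg_pairing E) => Ml Mr xx; split.
- elim/quotg_ind=> x; elim/quotg_ind=> y; elim/quotg_ind=> z.
  by rewrite -!gmulfJ -gmulfM !comm_liftE Ml.
- elim/quotg_ind=> x; elim/quotg_ind=> y; elim/quotg_ind=> z.
  by rewrite -!gmulfJ -gmulfM !comm_liftE Mr.
- by elim/quotg_ind=> x; rewrite comm_liftE xx.
Qed.

Definition xi : extsq (quotg N) -> E := extsq_lift comm_lift.
HB.instance Definition _ := isUMagmaMorphism.Build (extsq (quotg N)) E
  xi (extsq_liftM comm_lift_pairing).

Lemma xiE x y : xi (wedge (cosetg N x) (cosetg N y)) = [~ x, y].
Proof. by rewrite [LHS](extsq_liftE comm_lift_pairing) comm_liftE. Qed.

Lemma xi_derg t : xi t \in derg E.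
Proof.
elim/extsq_ind: t => [|s t ? ?|t ?|x y].
- by rewrite gmulf1 gpred1.
- by rewrite gmulfM gpredM.
- by rewrite gmulfV gpredV.
- by elim/quotg_ind: x => x; elim/quotg_ind: y => y; rewrite xiE mem_derg.
Qed.

Lemma cosetg_xi t : cosetg N (xi t) = kappa t.
Proof.
elim/extsq_ind: t => [|s t IHs IHt|t IHt|x y].
- by rewrite !gmulf1.
- by rewrite !gmulfM /= IHs IHt.
- by rewrite !gmulfV /= IHt.
- elim/quotg_ind: x => x; elim/quotg_ind: y => y.
  by rewrite xiE kappaE gmulfR.
Qed.

Lemma xi_Mext : {in Mext (quotg N), forall t, xi t \in capg N (derg E)}.
Proof.
move=> t /MextP kt; apply/capgP; split; last exact: xi_derg.
by apply/cosetg_eq1; rewrite cosetg_xi.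
Qed.

Lemma xi_M0ext :
  {in M0ext (quotg N), forall t, xi t \in geng (capg (comms E) N)}.
Proof.
apply: geng_map => t /asboolP[a [b [cab ->]]]; rewrite /=.
elim/quotg_ind: a cab => x; elim/quotg_ind: b => y cxy.
rewrite xiE; apply/mem_geng/capgP; split; first exact: mem_comms.
by apply/cosetg_eq1; rewrite gmulfR; apply/eqP/commgP.
Qed.

Lemma commsN_sub : {subset geng (capg (comms E) N) <= capg N (derg E)}.
Proof.
by apply: geng_sub => x /capgP[Kx Nx]; apply/capgP; split=> //; apply: mem_geng.
Qed.

(* (N n [E, E]) / < K(E) n N >                                                *)
Definition NE_quot := secg (capg N (derg E)) (geng (capg (comms E) N)).
HB.instance Definition _ := Group.on NE_quot.

Definition xi_star : B0 (quotg N) -> NE_quot := secg_map xi_Mext.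
HB.instance Definition _ := isUMagmaMorphism.Build (B0 (quotg N)) NE_quot
  xi_star (secg_mapM xi_Mext xi_M0ext).

Lemma xi_starE t (Mt : t \in Mext (quotg N))
    (Nt : xi t \in capg N (derg E)) :
  xi_star (to_secg (M0ext (quotg N)) Mt) = to_secg _ Nt.
Proof.
rewrite [LHS](secg_mapE xi_Mext xi_M0ext).
by apply/to_secgP; rewrite mulVg gpred1.
Qed.

End CentralQuotient.

Arguments eta_star {E} N a.
Arguments xi_star {E} N a.

(* Main.v *)
(* Write eta for the map E /\ E -> G /\ G. Everything follows from the        *)
(* factorisation xi \o eta = kappa_E, the surjectivity of eta, and the fact   *)
(* that xi maps M_0(G) onto < K(E) n N >: an element of M(G) that xi sends to *)
(* < K(E) n N > can be corrected by M_0(G) so that xi kills it, and then any  *)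
(* of its lifts to E /\ E lies in the kernel M(E) of kappa_E.                 *)
Require Import Defs.
From HB Require Import structures.
From mathcomp Require Import all_boot.
From mathcomp Require Import boolp.

Set Implicit Arguments.
Unset Strict Implicit.
Unset Printing Implicit Defensive.

Local Open Scope group_scope.

(** Put G = E/N. Since [xi] after the map of exterior squares is [kappa] on E ([xi_extsq_map]),
    [xi_star] kills the image of [eta_star]; the reverse inclusion is the correction argument of
    [kerg_xi_star]. Every element of N in [E,E] is a value of [kappa], hence of [xi] on M(G), so
    [xi_star] is onto, and exactness with the first isomorphism theorem gives the isomorphism. *)

Section FirstIsomorphism.
Variables (G K : groupType) (f : UMagmaMorphism.type G K).
Variables (N : normalClosed G).
Hypothesis kerN : kerg f =i N.

Definition quotg_lift (a : quotg N) : K := f (repr a).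

Lemma quotg_liftE x : quotg_lift (cosetg N x) = f x.
Proof.
have := repr_cosetg N x; rewrite -kerN => /kergP.
by rewrite gmulfM gmulfV => /mulg1_eq; rewrite invgK.
Qed.

Lemma quotg_liftM : monoid_morphism quotg_lift.
Proof.
split; first by rewrite [LHS]quotg_liftE gmulf1.
elim/quotg_ind=> x; elim/quotg_ind=> y.
by rewrite -gmulfM !quotg_liftE gmulfM.
Qed.
HB.instance Definition _ :=
  isUMagmaMorphism.Build (quotg N) K quotg_lift quotg_liftM.

Lemma quotg_lift_inj : injective quotg_lift.
Proof.
elim/quotg_ind=> x; elim/quotg_ind=> y; rewrite !quotg_liftE => fxy.
by apply/cosetgP; rewrite -kerN; apply/kergP; rewrite gmulfM gmulfV fxy mulVg.
Qed.

Lemma first_isomorphism : (forall y, y \in img f) -> isomorphic (quotg N) K.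
Proof.
move=> f_onto; exists quotg_lift.
have /choice[g fgK] y : exists x, f x = y by apply/imgP.
have lgK : cancel (fun y => cosetg N (g y)) quotg_lift.
  by move=> y; rewrite quotg_liftE.
by exists (fun y => cosetg N (g y)) => // a; apply: quotg_lift_inj.
Qed.

End FirstIsomorphism.

(** The image of [S] under [f] is a subgroup of [K], so lifting generators is enough. *)
Lemma geng_lift (G K : groupType) (f : UMagmaMorphism.type G K)
    (S : groupClosed G) (A : {pred K}) :
    {in A, forall y, exists2 x, x \in S & f x = y} ->
  {in geng A, forall y, exists2 x, x \in S & f x = y}.
Proof.
move=> liftA y Ay.
have sub_img : {subset geng A <= img (f \o (val : subg S -> G))}.
  apply: geng_sub => z /liftA[x Sx fx].
  by apply/imgP; exists (Subg Sx).
by have /imgP[[x Sx] /= fx] := sub_img y Ay; exists x.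
Qed.

Lemma kappa_surj (H : groupType) x :
  x \in derg H -> exists t : extsq H, kappa t = x.
Proof.
move=> Hx; apply/imgP; apply: (@geng_sub _ _ (img (@kappa H))) x Hx.
by move=> _ /asboolP[x [y ->]]; apply/imgP; exists (wedge x y); exact: kappaE.
Qed.

Lemma extsq_map_surj (G K : groupType) (f : UMagmaMorphism.type G K) :
  (forall y, y \in img f) -> forall t, exists s, extsq_map f s = t.
Proof.
move=> f_onto t; apply/imgP; elim/extsq_ind: t => [|s t Is It|t It|x y].
- exact: gpred1.
- exact: gpredM.
- exact: gpredVr.
have [/imgP[a <-] /imgP[b <-]] := (f_onto x, f_onto y).
by apply/imgP; exists (wedge a b); exact: extsq_mapE.
Qed.

Section CentralQuotient.
Variables (E : groupType) (N : centralClosed E).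

Lemma cosetg_surj (a : quotg N) : a \in img (cosetg N).
Proof. by apply/imgP; exists (repr a); exact: cosetg_repr. Qed.

Lemma xi_extsq_map s : xi (extsq_map (cosetg N) s) = kappa s.
Proof.
elim/extsq_ind: s => [|s t IHs IHt|t IHt|x y].
- by rewrite !gmulf1.
- by rewrite !gmulfM /= IHs IHt.
- by rewrite !gmulfV /= IHt.
- by rewrite extsq_mapE xiE kappaE.
Qed.

(** A commutator [x,y] lies in N exactly when xN and yN commute, which puts their wedge in
    M_0(G). *)
Lemma xi_M0ext_surj : {in geng (capg (comms E) N), forall n,
  exists2 t, t \in M0ext (quotg N) & xi t = n}.
Proof.
apply: geng_lift => _ /capgP[/asboolP[x [y ->]] Nxy].
exists (wedge (cosetg N x) (cosetg N y)); last exact: xiE.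
apply/mem_geng/asboolP; exists (cosetg N x), (cosetg N y); split=> //.
by apply/commgP/eqP; rewrite -gmulfR; apply/cosetg_eq1.
Qed.

Lemma xi_star_surj n : n \in img (xi_star N).
Proof.
elim/secg_ind: n => n An; have /capgP[Nn /kappa_surj[s ks]] := An.
have xis : xi (extsq_map (cosetg N) s) = n by rewrite xi_extsq_map.
(* [kappa] on G is [xi] followed by reduction mod N, and n is in N. *)
have Ms : extsq_map (cosetg N) s \in Mext (quotg N).
  by apply/MextP; rewrite -cosetg_xi xis; apply/cosetg_eq1.
have As : xi (extsq_map (cosetg N) s) \in capg N (derg E) by rewrite xis.
apply/imgP; exists (to_secg (M0ext _) Ms); rewrite /= (xi_starE Ms As).
by apply/to_secgP; rewrite xis mulVg gpred1.
Qed.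

Lemma img_eta_star : {subset img (eta_star N) <= kerg (xi_star N)}.
Proof.
move=> _ /imgP[s <-]; elim/secg_ind: s => s Ms; apply/kergP.
have Mes := extsq_map_Mext (cosetg N) Ms.
rewrite /= /eta_star (B0_mapE Ms Mes) (xi_starE Mes (xi_Mext Mes)).
rewrite -(to_secg1 _ (@gpred1 _ (capg N (derg E)))); apply/to_secgP.
by rewrite xi_extsq_map (MextP _ Ms) mulg1 invg1 gpred1.
Qed.

Lemma kerg_xi_star : {subset kerg (xi_star N) <= img (eta_star N)}.
Proof.
elim/secg_ind=> t Mt /kergP; rewrite /= (xi_starE Mt (xi_Mext Mt)).
rewrite -(to_secg1 _ (@gpred1 _ (capg N (derg E)))) => /to_secgP.
rewrite mulg1 gpredV => /xi_M0ext_surj[u M0u xiu].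
(* Dividing by [u] keeps the class in B_0(G) but makes [xi] trivial, which forces [kappa s = 1]. *)
have [s es] := extsq_map_surj cosetg_surj (t * u^-1).
have Ms : s \in Mext E.
  by apply/MextP; rewrite -xi_extsq_map es gmulfM gmulfV /= xiu mulgV.
have Mes := extsq_map_Mext (cosetg N) Ms.
apply/imgP; exists (to_secg _ Ms); rewrite /= /eta_star (B0_mapE Ms Mes).
by apply/to_secgP; rewrite es invgM invgK mulgVK.
Qed.

End CentralQuotient.

Theorem mainTheorem5 (E : groupType) (N : centralClosed E) :
  kerg (xi_star N) =i img (eta_star N) /\
  isomorphic (quotg (img (eta_star N))) (NE_quot N).
Proof.
have exact_at_B0 : kerg (xi_star N) =i img (eta_star N).
  by move=> t; apply/idP/idP; [exact: kerg_xi_star | exact: img_eta_star].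
(* The image is normal because B_0(G) is abelian. *)
split=> //; apply: (@first_isomorphism _ _ (xi_star N) (img (eta_star N))) => //.
exact: xi_star_surj.
Qed.
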